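(* Let $N\geq2$ be an even integer and let $W_{N/2}=\mathrm{span}_{\mathbb{C}}\langle w(z)\,\partial^{N/2}\mid w\in\mathcal{O}(\mathbb{C})\rangle$ be the $\mathcal{O}(\mathbb{C})$-module of holomorphic operators of order $N/2$. Then $W_{N/2}$ is endowed with the homotopy $N$-Lie algebra structure with respect to the bracket $$[A_1,\dots,A_N]=\sum_{\sigma\in S_N}(-1)^\sigma A_{\sigma(1)}\circ\dots\circ A_{\sigma(N)};$$ that is, $W_{N/2}$ is closed under this bracket and the bracket satisfies the $N$-Jacobi identity on $W_{N/2}$.
   Context: $\mathcal{O}(\mathbb{C})$ is the commutative algebra of Laurent series over $\mathbb{C}$ in the coordinate $z$ (with finitely many negative powers, so that products are defined), $\partial=d/dz$, and $w(z)\,\partial^{p}$ denotes the differential operator $f\mapsto w\cdot\partial^p(f)$ on $\mathcal{O}(\mathbb{C})$; $\circ$ is composition of operators and $(-1)^\sigma$ is the sign of $\sigma$. A vector space $V$ with an $N$-linear skew-symmetric bracket $\Delta:\bigwedge^N V\to V$ is a homotopy $N$-Lie algebra (Schlessinger–Stasheff $N$-algebra) if the $N$-Jacobi identity holds: for all $a_1,\dots,a_{2N-1}\in V$, $$\sum_{\sigma\in S^N_{2N-1}}(-1)^\sigma\Delta\bigl(\Delta(a_{\sigma(1)},\ldots,a_{\sigma(N)}),a_{\sigma(N+1)},\ldots,a_{\sigma(2N-1)}\bigr)=0,$$ where $S^N_{2N-1}$ is the set of permutations $\sigma\in S_{2N-1}$ with $\sigma(1)<\dots<\sigma(N)$ and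 $\sigma(N+1)<\dots<\sigma(2N-1)$. *)

(* Defs.v *)
From HB Require Import structures.
From mathcomp Require Import all_boot all_order all_fingroup all_algebra.
From mathcomp Require Import boolp classical_sets functions cardinality fsbigop.
From mathcomp Require Import reals.
From mathcomp Require Export complex.
From mathcomp Require Import zify.

Set Implicit Arguments.
Unset Strict Implicit.
Unset Printing Implicit Defensive.

Import Order.TTheory GRing.Theory Num.Theory.
Local Open Scope classical_set_scope.
Local Open Scope ring_scope.

(* Formal Laurent series sum_n (f n) z^n with coefficients in K and finitely
   many negative powers; over K = C this is the algebra O(C). *)
Section LaurentSeries.
Variable K : comNzRingType.

Definition bounded_below (f : int -> K) : bool :=
  `[< exists m : int, forall n : int, n < m -> f n = 0 >].

Lemma bounded_belowP (f : int -> K) :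
  reflect (exists m : int, forall n : int, n < m -> f n = 0) (bounded_below f).
Proof. exact: asboolP. Qed.

Record laurent := Laurent {
  lcoef :> int -> K;
  lcoef_bounded_below : bounded_below lcoef }.

HB.instance Definition _ := [isSub for lcoef].
HB.instance Definition _ := [Choice of laurent by <:].

Lemma laurentP (f g : laurent) : f =1 g -> f = g.
Proof. by move=> fg; apply/val_inj/funext. Qed.

Lemma laurent_bound (f : laurent) :
  exists m : int, forall n : int, n < m -> f n = 0.
Proof. exact/bounded_belowP/lcoef_bounded_below. Qed.

Fact bounded_below_zmod : zmod_closed bounded_below.
Proof.
split=> [|f g /bounded_belowP[a fa] /bounded_belowP[b gb]];
  apply/bounded_belowP; first by exists 0.
exists (Num.min a b) => n; rewrite lt_min => /andP[na nb].
by rewrite opprfctE addrfctE fa // gb // subr0.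
Qed.
HB.instance Definition _ :=
  GRing.isZmodClosed.Build (int -> K) bounded_below bounded_below_zmod.
HB.instance Definition _ := [SubChoice_isSubZmodule of laurent by <:].

Lemma lcoefD (f g : laurent) n : (f + g) n = f n + g n.
Proof. by []. Qed.

Fact lscale_subproof (c : K) (f : laurent) :
  bounded_below (fun n => c * f n).
Proof.
have [m fm] := laurent_bound f; apply/bounded_belowP; exists m => n nm.
by rewrite fm // mulr0.
Qed.
Definition lscale c f := Laurent (lscale_subproof c f).

Fact lscaleA a b f : lscale a (lscale b f) = lscale (a * b) f.
Proof. by apply: laurentP => n; rewrite /= mulrA. Qed.
Fact lscale1 : left_id 1 lscale.
Proof. by move=> f; apply: laurentP => n; rewrite /= mul1r. Qed.
Fact lscaleDr : right_distributive lscale +%R.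
Proof.
by move=> c f g; apply: laurentP => n; rewrite lcoefD /= mulrDr.
Qed.
Fact lscaleDl f : {morph lscale^~ f : a b / a + b}.
Proof. by move=> a b; apply: laurentP => n; rewrite lcoefD /= mulrDl. Qed.
HB.instance Definition _ := GRing.Zmodule_isLmodule.Build K laurent
  lscaleA lscale1 lscaleDr lscaleDl.

(* The set of indices i with f i * g (n - i) != 0 is finite, so that the finite
   support sum below is the n-th coefficient of the Cauchy product. *)
Definition lconv (f g : int -> K) (n : int) : K :=
  \sum_(i \in [set: int]) f i * g (n - i).

Lemma fsum_int (h : int -> K) (a : int) (m : nat) :
  (forall i, i < a -> h i = 0) -> (forall i, a + m%:Z <= i -> h i = 0) ->
  \sum_(i \in [set: int]) h i = \sum_(k < m) h (a + k%:Z).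
Proof.
move=> ha hm.
pose r := [seq a + k%:Z | k <- iota 0 m].
rewrite (fsbigE r) //=; last first.
- move=> i _ /mapP ir; have [/ha //|ai] := ltP i a.
  apply: hm; case: leP => // im; case: ir.
  by exists (absz (i - a)%R); rewrite ?mem_iota; lia.
- by rewrite map_inj_uniq ?iota_uniq // => i j; lia.
under eq_bigl do rewrite in_setT.
by rewrite big_map -[in LHS](subn0 m) -/(index_iota 0 m) big_mkord.
Qed.

Lemma lconv_lt (f g : int -> K) (a b : int) :
  (forall i, i < a -> f i = 0) -> (forall i, i < b -> g i = 0) ->
  forall n, n < a + b -> lconv f g n = 0.
Proof.
move=> fa gb n nab; apply: fsbig1 => i _.
have [/fa->|ai] := ltP i a; first by rewrite mul0r.
by rewrite gb ?mulr0 //; lia.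
Qed.

Lemma lconvE (f g : int -> K) (a b n : int) (m : nat) :
  (forall i, i < a -> f i = 0) -> (forall i, i < b -> g i = 0) ->
  n < a + b + m%:Z ->
  lconv f g n = \sum_(k < m) f (a + k%:Z) * g (n - (a + k%:Z)).
Proof.
move=> fa gb nabm; rewrite /lconv.
rewrite (@fsum_int (fun i => f i * g (n - i)) a m) //.
  by move=> i /fa->; rewrite mul0r.
by move=> i ami; rewrite gb ?mulr0 //; lia.
Qed.

Fact lmul_subproof (f g : laurent) : bounded_below (lconv f g).
Proof.
have [a fa] := laurent_bound f; have [b gb] := laurent_bound g.
by apply/bounded_belowP; exists (a + b); apply: lconv_lt.
Qed.
Definition lmul f g := Laurent (lmul_subproof f g).

Fact lone_subproof : bounded_below (fun n : int => (n == 0)%:R : K).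
Proof.
by apply/bounded_belowP; exists 0 => n; rewrite lt_neqAle => /andP[/negPf->].
Qed.
Definition lone := Laurent lone_subproof.

Fact lmulC : commutative lmul.
Proof.
move=> f g; apply: laurentP => n /=; rewrite /lconv.
rewrite (@reindex_fsbigT _ _ _ _ _ (fun i : int => n - i)); last first.
  by exists (fun i : int => n - i) => i; lia.
by apply: eq_fsbigr => i _; rewrite mulrC; congr (g _ * f _); lia.
Qed.

Fact lmul1 : left_id lone lmul.
Proof.
move=> f; apply: laurentP => n /=; rewrite /lconv.
rewrite (@fsum_int _ 0 1).
- by rewrite big_ord1 addr0 /= mul1r subr0.
- by move=> i i0; rewrite (_ : (i == 0) = false) ?mul0r //; lia.
- by move=> i i0; rewrite (_ : (i == 0) = false) ?mul0r //; lia.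
Qed.

Fact lmulDl : left_distributive lmul +%R.
Proof.
move=> f g h; apply: laurentP => n; rewrite lcoefD /=.
have [a fa] := laurent_bound f; have [b gb] := laurent_bound g.
have [c hc] := laurent_bound h.
pose d : int := Num.min a b.
have fd i : i < d -> f i = 0 by rewrite lt_min => /andP[/fa].
have gd i : i < d -> g i = 0 by rewrite lt_min => /andP[_ /gb].
have fgd i : i < d -> (f + g) i = 0.
  by move=> id; rewrite lcoefD fd // gd // addr0.
pose m := (absz (n - d - c)%R).+1.
have nm : n < d + c + m%:Z by rewrite /m; lia.
rewrite (lconvE fgd hc nm) (lconvE fd hc nm) (lconvE gd hc nm) -big_split /=.
by apply: eq_bigr => k _; rewrite mulrDl.
Qed.

Fact lmulA : associative lmul.
Proof.
move=> f g h; apply: laurentP => n /=.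
have [a fa] := laurent_bound f; have [b gb] := laurent_bound g.
have [c hc] := laurent_bound h.
pose m := (absz (n - a - b - c)%R).+1.
rewrite (lconvE fa (lconv_lt gb hc) (m := m)); last by rewrite /m; lia.
rewrite (lconvE (lconv_lt fa gb) hc (m := m)); last by rewrite /m; lia.
have E (i : 'I_m) :
    lconv f g (a + b + i%:Z) * h (n - (a + b + i%:Z)) =
    \sum_(k < m) f (a + k%:Z) *
      (g (a + b + i%:Z - (a + k%:Z)) * h (n - (a + b + i%:Z))).
  have [hi|hi] := ltP (n - (a + b + i%:Z)) c.
    by rewrite hc // mulr0 big1 // => k _; rewrite !mulr0.
  rewrite (lconvE fa gb (m := m)); last by have := ltn_ord i; lia.
  by rewrite mulr_suml; apply: eq_bigr => k _; rewrite mulrA.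
rewrite (eq_bigr _ (fun i _ => E i)) exchange_big /=; apply: eq_bigr => k _.
rewrite -mulr_sumr; congr (_ * _); rewrite /lconv.
rewrite (@reindex_fsbigT _ _ _ _ _ (fun i : int => i - (a + k%:Z))); last first.
  by exists (fun i : int => i + (a + k%:Z)) => i; lia.
rewrite (@fsum_int _ (a + b) m).
- by apply: eq_bigr => i _; congr (_ * h _); lia.
- by move=> i ib; rewrite gb ?mul0r //; lia.
- by move=> i ib; rewrite hc ?mulr0 //; rewrite /m in ib; lia.
Qed.

Fact lone_neq0 : lone != 0.
Proof.
by apply/eqP => /(congr1 (fun f : laurent => f 0)) /eqP; rewrite /= oner_eq0.
Qed.

HB.instance Definition _ := GRing.Zmodule_isComNzRing.Build laurent
  lmulA lmulC lmul1 lmulDl lone_neq0.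

Fact lscaleAl (c : K) (f g : laurent) : c *: (f * g) = (c *: f) * g.
Proof.
have [a fa] := laurent_bound f; have [b gb] := laurent_bound g.
apply: laurentP => n.
change (c * lconv f g n = lconv (fun i => c * f i) g n).
pose m := (absz (n - a - b)%R).+1.
rewrite (lconvE fa gb (m := m)); last by rewrite /m; lia.
rewrite (lconvE _ gb (a := a) (m := m)); last 2 first.
- by move=> i /fa ->; rewrite mulr0.
- by rewrite /m; lia.
by rewrite mulr_sumr; apply: eq_bigr => k _; rewrite mulrA.
Qed.
HB.instance Definition _ := GRing.Lmodule_isLalgebra.Build K laurent lscaleAl.
HB.instance Definition _ := GRing.Lalgebra_isComAlgebra.Build K laurent.

Fact lderiv_subproof (f : laurent) :
  bounded_below (fun n => (n + 1)%:~R * f (n + 1)).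
Proof.
have [m fm] := laurent_bound f; apply/bounded_belowP; exists (m - 1) => n nm.
by rewrite fm ?mulr0 //; lia.
Qed.
(* The derivation d/dz, z being the coordinate. *)
Definition lderiv f := Laurent (lderiv_subproof f).

End LaurentSeries.

Section HomotopyLie.

Definition upd (N : nat) (V : Type) (a : 'I_N -> V) (i : 'I_N) (x : V) :
  'I_N -> V := fun j => if j == i then x else a j.

Variables (K : comNzRingType) (V : lmodType K) (N : nat).
Variable Delta : ('I_N -> V) -> V.

Definition multilinear : Prop :=
  forall (a : 'I_N -> V) (i : 'I_N) (c : K) (x y : V),
    Delta (upd a i (c *: x + y)) = c *: Delta (upd a i x) + Delta (upd a i y).

Definition skew_symmetric : Prop :=
  forall (a : 'I_N -> V) (s : 'S_N),
    Delta (a \o s) = (-1) ^+ odd_perm s *: Delta a.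

(* Indices start at 0, and 2N - 1 is written (N.-1).*2.+1 (the two agree for
   N > 0).  The first block of indices is {0, ..., N - 1} and the second one is
   {N, ..., 2N - 2}. *)
Definition unshuffle (s : 'S_(N.-1).*2.+1) : bool :=
  [forall i : 'I_(N.-1).*2.+1, forall j : 'I_(N.-1).*2.+1,
    (i < j)%N && ((j < N)%N || (N <= i)%N) ==> (s i < s j)%N].

(* The argument in position i > 0 of the outer bracket is the one of index
   N + i - 1 in the permuted list; every use of inord is within bounds. *)
Definition jacobi_term (a : 'I_(N.-1).*2.+1 -> V) (s : 'S_(N.-1).*2.+1) : V :=
  Delta (fun i : 'I_N =>
    if i == 0%N :> nat then Delta (fun j : 'I_N => a (s (inord j)))
    else a (s (inord (N + i.-1)))).

Definition jacobi_identity : Prop :=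
  forall a : 'I_(N.-1).*2.+1 -> V,
    \sum_(s | unshuffle s) (-1) ^+ odd_perm s *: jacobi_term a s = 0.

Definition homotopy_lie : Prop :=
  [/\ multilinear, skew_symmetric & jacobi_identity].

End HomotopyLie.

Section Operators.
Variable K : comNzRingType.

Local Notation operator := (laurent K -> laurent K).

(* The operator w d^p, for d = d/dz. *)
Definition wdp (w : laurent K) (p : nat) : operator :=
  fun f => w * iter p (@lderiv K) f.

(* The big operator is the composition A (s 0) \o ... \o A (s (N - 1)). *)
Definition obracket (N : nat) (A : 'I_N -> operator) : operator :=
  \sum_(s : 'S_N) (-1) ^+ odd_perm s *:
    \big[@comp _ _ _/id]_(i < N) A (s i).

(* Membership in the K-linear span of the operators w d^p. *)
Definition in_W (p : nat) (A : operator) : bool :=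
  `[< exists (n : nat) (c : 'I_n -> K) (w : 'I_n -> laurent K),
        A = \sum_(i < n) c i *: wdp (w i) p >].

Lemma in_WP (p : nat) (A : operator) :
  reflect (exists w : laurent K, A = wdp w p) (in_W p A).
Proof.
apply: (iffP (asboolP _)) => [[n [c [w ->]]]|[w ->]]; last first.
  exists 1%N, (fun=> 1), (fun=> w); by rewrite big_ord1 scale1r.
exists (\sum_(i < n) c i *: w i); apply/funext => f.
rewrite fct_sumE /wdp mulr_suml; apply: eq_bigr => i _.
by rewrite -scalerAl.
Qed.

Fact in_W_submod (p : nat) : submod_closed (in_W p).
Proof.
split=> [|c A B /in_WP[v ->] /in_WP[w ->]]; apply/in_WP.
  by exists 0; apply/funext => f; rewrite /wdp mul0r.
exists (c *: v + w); apply/funext => f.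
by rewrite /wdp mulrDl -scalerAl.
Qed.
HB.instance Definition _ (p : nat) :=
  GRing.isSubmodClosed.Build K operator (in_W p) (in_W_submod p).

Record W (p : nat) := InW { W_op :> operator; W_opP : in_W p W_op }.
HB.instance Definition _ (p : nat) := [isSub for @W_op p].
HB.instance Definition _ (p : nat) := [Choice of W p by <:].
HB.instance Definition _ (p : nat) := [SubChoice_isSubLmodule of W p by <:].

End Operators.

(* Main.v *)
From HB Require Import structures.
Require Import Defs.
From mathcomp Require Import all_boot all_order all_fingroup all_algebra.
From mathcomp Require Import boolp functions.
From mathcomp Require Import reals complex zify.

Set Implicit Arguments.
Unset Strict Implicit.
Unset Printing Implicit Defensive.

Import Order.TTheory GRing.Theory Num.Theory.
Local Open Scope ring_scope.
Local Open Scope complex_scope.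

(** Everything follows from counting derivatives.  Call weight of a monomial
    w_0^(k_0) ... w_(n-1)^(k_(n-1)), in which each of n Laurent series occurs
    once, the number k_0 + ... + k_(n-1) of derivatives in it.  Its alternating
    sum over the permutations of the w_i is the determinant of the matrix of
    the derivatives w_j^(k_i), which has two equal rows unless the k_i are
    pairwise distinct.  It thus vanishes as soon as the weight is smaller than
    0 + 1 + ... + (n-1) (alternate_diffpoly_eq0).

    Put p = N/2.  In the composite w_0 d^p w_1 d^p ... w_(N-1) d^p applied to f,
    regard g = d^p f as one more variable.  Expanding by the Leibniz rule gives
    monomials w_0^(k_0) ... w_(N-1)^(k_(N-1)) g^(l) of weight
    (N-1) p = 0 + ... + (N-1), the value at which p = N/2 matters.  If l > 0 the
    w_i carry too few derivatives to survive alternation, so that the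
    alternating sum is u(w) g = u(w) d^p f, where u is a combination of
    monomials of weight N(N-1)/2 (a multiple of the Wronskian).  This is closure
    of the bracket (obracket_wdp).

    The nested bracket corresponds to u(u(w_0, ..., w_(N-1)), w_N, ...), a
    combination of monomials of weight N(N-1) in 2N-1 series.  As
    N(N-1) < (2N-1)(N-1) = 0 + ... + (2N-2), its alternating sum over all of
    S_(2N-1) vanishes (alternate_nested_eq0).  The Jacobi sum runs only over
    unshuffles, which represent the cosets of the Young subgroup S_N x S_(N-1);
    by skew-symmetry the signed term is constant on each coset, so the full sum
    is the order of that subgroup times the Jacobi sum (sum_jacobi_term), and
    this order is invertible in characteristic 0. *)

(** * Derivatives of Laurent series *)

Section Derivation.
Variable K : comNzRingType.
Local Notation L := (laurent K).
Local Notation D := (@lderiv K).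

Fact lderiv_is_linear : linear D.
Proof.
move=> c f g; apply: laurentP => n.
change ((n + 1)%:~R * (c * f (n + 1) + g (n + 1)) =
  c * ((n + 1)%:~R * f (n + 1)) + (n + 1)%:~R * g (n + 1)).
by rewrite mulrDr mulrCA.
Qed.
HB.instance Definition _ :=
  GRing.isLinear.Build K L L *:%R D lderiv_is_linear.

Lemma lderivM (f g : L) : D (f * g) = D f * g + f * D g.
Proof.
have [a fa] := laurent_bound f; have [b gb] := laurent_bound g.
apply: laurentP => n; rewrite lcoefD.
change ((n + 1)%:~R * lconv f g (n + 1) = lconv (D f) g n + lconv f (D g) n).
pose m := (absz (n + 1 - a - b)%R).+2.
rewrite (lconvE fa gb (m := m)); last by rewrite /m; lia.
rewrite (@lconvE _ (D f) g (a - 1) b n m) //; last 2 first.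
- by move=> i ia; rewrite /= fa ?mulr0 //; lia.
- by rewrite /m; lia.
rewrite (@lconvE _ f (D g) a (b - 1) n m) //; last 2 first.
- by move=> i ib; rewrite /= gb ?mulr0 //; lia.
- by rewrite /m; lia.
rewrite mulr_sumr -big_split /=; apply: eq_bigr => k _.
have -> : a - 1 + k%:Z + 1 = a + k%:Z by lia.
have -> : n - (a - 1 + k%:Z) = n + 1 - (a + k%:Z) by lia.
have -> : n - (a + k%:Z) + 1 = n + 1 - (a + k%:Z) by lia.
set x := f _; set y := g _.
have -> : ((n + 1)%:~R : K) = (a + k%:Z)%:~R + (n + 1 - (a + k%:Z))%:~R.
  by rewrite -intrD; congr (_%:~R); lia.
by rewrite mulrDl mulrA mulrCA.
Qed.

Lemma lderiv1 : D 1 = 0.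
Proof.
have := lderivM 1 1; rewrite !(mulr1, mul1r) => D11.
by apply: (addrI (D 1)); rewrite addr0.
Qed.

Lemma iter_lderiv_linear n : linear (iter n D).
Proof. by move=> c f g; elim: n => //= n ->; rewrite linearP. Qed.

End Derivation.

(** * Multilinear differential polynomials *)

Section DiffPoly.
Variable K : comNzRingType.
Local Notation L := (laurent K).
Local Notation D := (@lderiv K).

Definition diffmon (I : Type) (s : seq (I * nat)) (w : I -> L) : L :=
  \prod_(x <- s) iter x.2 D (w x.1).

Lemma diffmon_cons (I : Type) x (s : seq (I * nat)) w :
  diffmon (x :: s) w = iter x.2 D (w x.1) * diffmon s w.
Proof. exact: big_cons. Qed.

(** Span of the monomials of weight d whose variables are, with multiplicity,
    those listed in e.  A list e, instead of a set, lets products concatenate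
    contents with no disjointness condition; that each variable occurs exactly
    once is only imposed at the end, by taking for e an enumeration. *)
Inductive diffpoly (I : eqType) (e : seq I) (d : nat) :
    ((I -> L) -> L) -> Prop :=
| Diffmon s of perm_eq (unzip1 s) e & sumn (unzip2 s) = d :
    diffpoly e d (diffmon s)
| Diffzero : diffpoly e d (fun=> 0)
| Difflin c P Q of diffpoly e d P & diffpoly e d Q :
    diffpoly e d (fun w => c *: P w + Q w).

Section Closure.
Variable I : eqType.
Implicit Types (e : seq I) (P Q : (I -> L) -> L).

Lemma eq_diffpoly e d P Q : P =1 Q -> diffpoly e d P -> diffpoly e d Q.
Proof. by move/funext->. Qed.

Lemma perm_diffpoly e e' d P :
  perm_eq e e' -> diffpoly e d P -> diffpoly e' d P.
Proof.
move=> ee'; elim=> [s se sd||c {}P Q _ IP _ IQ]; last exact: Difflin.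
- by apply: Diffmon => //; apply: perm_trans ee'.
- exact: Diffzero.
Qed.

Lemma diffpolyZ e d c P : diffpoly e d P -> diffpoly e d (fun w => c *: P w).
Proof.
move=> dP; apply: (eq_diffpoly _ (Difflin c dP (Diffzero e d))) => w.
by rewrite addr0.
Qed.

Lemma diffpolyD e d P Q :
  diffpoly e d P -> diffpoly e d Q -> diffpoly e d (fun w => P w + Q w).
Proof.
move=> dP dQ; apply: (eq_diffpoly _ (Difflin 1 dP dQ)) => w.
by rewrite scale1r.
Qed.

Lemma diffpoly_sum (J : Type) (r : seq J) e d (P : J -> (I -> L) -> L) :
  (forall j, diffpoly e d (P j)) -> diffpoly e d (fun w => \sum_(j <- r) P j w).
Proof.
move=> dP; elim: r => [|j r IHr].
  by apply: (eq_diffpoly _ (Diffzero e d)) => w; rewrite big_nil.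
by apply: (eq_diffpoly _ (diffpolyD (dP j) IHr)) => w; rewrite big_cons.
Qed.

Lemma diffpoly_var (i : I) : diffpoly [:: i] 0 (fun w => w i).
Proof.
apply: (@eq_diffpoly _ _ (diffmon [:: (i, 0)])); last exact: Diffmon.
by move=> w; rewrite /diffmon big_seq1.
Qed.

Lemma diffpoly_one : diffpoly ([::] : seq I) 0 (fun=> 1).
Proof.
apply: (@eq_diffpoly _ _ (diffmon [::])); last exact: Diffmon.
by move=> w; rewrite /diffmon big_nil.
Qed.

Lemma diffpolyM e1 e2 d1 d2 P Q : diffpoly e1 d1 P -> diffpoly e2 d2 Q ->
  diffpoly (e1 ++ e2) (d1 + d2) (fun w => P w * Q w).
Proof.
move=> dP dQ; elim: dP => [s se sd||c P1 P2 _ IP1 _ IP2]; last first.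
- apply: (eq_diffpoly _ (Difflin c IP1 IP2)) => w.
  by rewrite mulrDl scalerAl.
- by apply: (eq_diffpoly _ (Diffzero _ _)) => w; rewrite mul0r.
elim: dQ => [t te td||c Q1 Q2 _ IQ1 _ IQ2]; last first.
- apply: (eq_diffpoly _ (Difflin c IQ1 IQ2)) => w.
  by rewrite mulrDr scalerAr.
- by apply: (eq_diffpoly _ (Diffzero _ _)) => w; rewrite mulr0.
apply: (@eq_diffpoly _ _ (diffmon (s ++ t))).
  by move=> w; rewrite /diffmon big_cat.
by apply: Diffmon; rewrite /unzip1 /unzip2 map_cat ?sumn_cat ?sd ?td ?perm_cat.
Qed.

Lemma diffpoly_lderiv e d P :
  diffpoly e d P -> diffpoly e d.+1 (fun w => D (P w)).
Proof.
elim=> [s se <-||c P1 P2 _ IP1 _ IP2]; last first.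
- by apply: (eq_diffpoly _ (Difflin c IP1 IP2)) => w; rewrite linearP.
- by apply: (eq_diffpoly _ (Diffzero _ _)) => w; rewrite raddf0.
apply: (perm_diffpoly se) => {e se}; elim: s => [|[i n] s IHs].
  apply: (eq_diffpoly _ (Diffzero _ _)) => w.
  by rewrite /diffmon big_nil lderiv1.
have dn q : diffpoly [:: i] q (diffmon [:: (i, q)]).
  by apply: Diffmon => //=; rewrite addn0.
have ds : diffpoly (unzip1 s) (sumn (unzip2 s)) (diffmon s) by exact: Diffmon.
have h1 := diffpolyM (dn n.+1) ds; have h2 := diffpolyM (dn n) IHs.
rewrite addnS in h2.
apply: (eq_diffpoly _ (diffpolyD h1 h2)) => w.
by rewrite !diffmon_cons lderivM /diffmon !big_nil !mulr1.
Qed.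

Lemma diffpoly_iter_lderiv n e d P :
  diffpoly e d P -> diffpoly e (d + n) (fun w => iter n D (P w)).
Proof.
elim: n => [|n IHn] dP; first by rewrite addn0.
by rewrite addnS; apply/diffpoly_lderiv/IHn.
Qed.

End Closure.

(** Weights add under substitution, because the Leibniz rule only distributes
    the derivatives that fall on a substituted polynomial. *)
Lemma diffpoly_comp (I J : eqType) (e : seq I) d (P : (I -> L) -> L)
    (e' : I -> seq J) (d' : I -> nat) (Q : I -> (J -> L) -> L) :
  diffpoly e d P -> (forall i, diffpoly (e' i) (d' i) (Q i)) ->
  diffpoly (flatten (map e' e)) (d + \sum_(i <- e) d' i)
    (fun w => P (fun i => Q i w)).
Proof.
move=> dP dQ; elim: dP => [s se <-||c P1 P2 _ IP1 _ IP2]; last first.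
- exact: Difflin IP1 IP2.
- exact: Diffzero.
rewrite -(perm_big _ se) /=.
apply: (perm_diffpoly (perm_flatten (perm_map e' se))).
elim: s {e se} => [|[i n] s IHs] /=.
  rewrite big_nil; apply: (eq_diffpoly _ (diffpoly_one _)) => w.
  by rewrite /diffmon big_nil.
rewrite big_cons addnACA (addnC n).
apply: (eq_diffpoly _ (diffpolyM (diffpoly_iter_lderiv n (dQ i)) IHs)) => w.
by rewrite diffmon_cons.
Qed.

(** When no variable is repeated, a monomial is given by the function k that
    maps each variable to its order of derivation. *)
Lemma diffmon_uniq (I : eqType) (e : seq I) (s : seq (I * nat)) :
    uniq e -> perm_eq (unzip1 s) e ->
  exists k : I -> nat,
    sumn (unzip2 s) = (\sum_(i <- e) k i)%N /\
    forall w, diffmon s w = \prod_(i <- e) iter (k i) D (w i).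
Proof.
move=> ue se; have: uniq (unzip1 s) by rewrite (perm_uniq se).
suff H : uniq (unzip1 s) -> exists k, s = [seq (i, k i) | i <- unzip1 s].
  move=> /H[k sk]; exists k; split.
    by rewrite -(perm_big _ se) sumnE {1}sk /= !big_map.
  by move=> w; rewrite -(perm_big _ se) {1}/diffmon {1}sk big_map.
elim: s {e ue se} => [|[i n] s IHs] /=; first by exists (fun=> 0).
move=> /andP[nis /IHs[k sk]].
exists (fun j => if j == i then n else k j); rewrite eqxx; congr cons.
rewrite {1}sk; apply/eq_in_map => j js.
by case: eqP => // ji; rewrite -ji js in nis.
Qed.

End DiffPoly.

(** * Alternating sums *)

Lemma sum_ord_leq_uniq (s : seq nat) :
  uniq s -> (\sum_(i < size s) i <= sumn s)%N.
Proof.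
move=> us; rewrite -(perm_sumn (permEl (perm_sort leq s))) -(size_sort leq s).
have: sorted ltn (sort leq s).
  by rewrite ltn_sorted_uniq_leq sort_uniq us sort_sorted //; exact: leq_total.
move: (sort leq s) => {us}s ss.
rewrite sumnE (big_nth 0) big_mkord; apply: leq_sum => -[i /= lis] _.
elim: i lis => [//|i IHi] lis.
apply: leq_ltn_trans (IHi (ltnW lis)) _.
by apply: (sorted_ltn_nth ltn_trans) => //; rewrite inE ltnW.
Qed.

Section Alternation.
Variable K : comNzRingType.
Local Notation L := (laurent K).
Local Notation D := (@lderiv K).

(** Pairwise distinct orders k i would sum to at least 0 + 1 + ... + (n-1);
    hence two of them agree, and the sum is a determinant with two equal
    rows. *)
Lemma alternate_diffmon_eq0 n (k : 'I_n -> nat) (w : 'I_n -> L) :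
  (\sum_i k i < \sum_(i < n) i)%N ->
  \sum_(s : 'S_n) (-1) ^+ s * \prod_i iter (k i) D (w (s i)) = 0.
Proof.
move=> lek; have [/injectiveP ik|/injectivePn[i [j nij kij]]] :=
  boolP (injectiveb k).
  have := @sum_ord_leq_uniq (map k (enum 'I_n)).
  rewrite map_inj_uniq ?enum_uniq // size_map size_enum_ord => /(_ isT).
  by rewrite sumnE big_map big_enum leqNgt lek.
pose M := \matrix_(i, j) iter (k i) D (w j).
rewrite -[RHS](determinant_alternate (A := M) nij).
  by apply: eq_bigr => s _; congr (_ * _); apply: eq_bigr => a _; rewrite mxE.
by move=> a; rewrite !mxE kij.
Qed.

Lemma alternate_diffpoly_eq0 n d (P : ('I_n -> L) -> L) w :
  diffpoly (enum 'I_n) d P -> (d < \sum_(i < n) i)%N ->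
  \sum_(s : 'S_n) (-1) ^+ s *: P (w \o s) = 0.
Proof.
move=> dP; elim: dP => [s se <- sd||c P1 P2 _ IP1 _ IP2 dn]; last first.
- transitivity (c *: \sum_(s : 'S_n) (-1) ^+ s *: P1 (w \o s) +
                \sum_(s : 'S_n) (-1) ^+ s *: P2 (w \o s)).
    rewrite scaler_sumr -big_split; apply: eq_bigr => s _.
    by rewrite /= scalerDr !scalerA mulrC.
  by rewrite IP1 // IP2 // scaler0 addr0.
- by move=> _; apply: big1 => s _; rewrite scaler0.
have [k [sk wk]] := diffmon_uniq K (enum_uniq _) se.
rewrite sk big_enum in sd.
rewrite -[RHS](alternate_diffmon_eq0 w sd); apply: eq_bigr => t _.
by rewrite wk big_enum /= scaler_sign mulr_sign.
Qed.

(** The variable None is left fixed by the alternation, and plays the part of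
    the function g on which a differential operator acts.  At the critical
    weight any derivative that falls on g is missing from the other variables,
    whose alternating sum then vanishes: the operator has order 0. *)
Lemma alternate_diffpoly_max n (P : (option 'I_n -> L) -> L) :
  diffpoly (None :: map Some (enum 'I_n)) (\sum_(i < n) i) P ->
  exists u, diffpoly (enum 'I_n) (\sum_(i < n) i) u /\
    forall w g,
      \sum_(s : 'S_n) (-1) ^+ s *: P (oapp (w \o s) g) = u w * g.
Proof.
set d := (\sum_(i < n) i)%N.
elim=> [s se sd||c P1 P2 _ [u1 [du1 H1]] _ [u2 [du2 H2]]]; last first.
- exists (fun w => c *: u1 w + u2 w); split; first exact: Difflin.
  move=> w g; rewrite mulrDl -scalerAl -H1 -H2 scaler_sumr -big_split /=.
  by apply: eq_bigr => s _; rewrite scalerDr !scalerA mulrC.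
- exists (fun=> 0); split; first exact: Diffzero.
  by move=> w g; rewrite mul0r; apply: big1 => s _; rewrite scaler0.
have ue : uniq (None :: map Some (enum 'I_n)).
  rewrite /= map_inj_uniq ?enum_uniq ?andbT; last by move=> ? ? [].
  by apply/mapP => -[].
have [k [sk wk]] := diffmon_uniq K ue se.
rewrite big_cons big_map big_enum /= in sk.
exists (fun w => if k None is 0%N then
  \sum_(s : 'S_n) (-1) ^+ s *: \prod_i iter (k (Some i)) D (w (s i)) else 0).
split=> [|w g].
  case k0 : (k None) sk => [|q] sk; last exact: Diffzero.
  apply: diffpoly_sum => t; apply: diffpolyZ.
  apply: (@eq_diffpoly _ _ _ _
      (diffmon [seq (t i, k (Some i)) | i <- enum 'I_n])).
    by move=> w; rewrite /diffmon big_map big_enum.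
  apply: Diffmon; rewrite /unzip1 /unzip2 -map_comp.
    apply: uniq_perm; [|exact: enum_uniq|].
      by rewrite map_inj_uniq ?enum_uniq // => i j /perm_inj.
    move=> i; rewrite mem_enum; apply/mapP; exists (t^-1%g i).
      by rewrite mem_enum.
    by rewrite /= permKV.
  by rewrite sumnE big_map big_enum /= -[RHS]sd sk.
have -> : \sum_(t : 'S_n) (-1) ^+ t *: diffmon s (oapp (w \o t) g) =
    (\sum_(t : 'S_n) (-1) ^+ t * \prod_i iter (k (Some i)) D (w (t i))) *
    iter (k None) D g.
  rewrite mulr_suml; apply: eq_bigr => t _.
  rewrite wk big_cons big_map big_enum /= scaler_sign -mulrA mulr_sign.
  by rewrite mulrC.
case k0 : (k None) sk => [|q] sk.
  by congr (_ * _); apply: eq_bigr => t _; rewrite scaler_sign mulr_sign.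
by rewrite alternate_diffmon_eq0 ?mul0r // -/d -sd sk addSn ltnS leq_addl.
Qed.

End Alternation.

Lemma diffpoly_multilinear (K : comNzRingType) n d
    (P : ('I_n -> laurent K) -> laurent K) :
  diffpoly (enum 'I_n) d P -> multilinear P.
Proof.
move=> dP w i c x y; elim: dP => [s se _||a P1 P2 _ IP1 _ IP2]; last first.
- rewrite IP1 IP2 !scalerDr !scalerA (mulrC a) -!addrA; congr (_ + _).
  by rewrite addrCA.
- by rewrite scaler0 addr0.
have [k [_ wk]] := diffmon_uniq K (enum_uniq _) se.
have E z : diffmon s (upd w i z) =
    iter (k i) (@lderiv K) z * \prod_(j | j != i) iter (k j) (@lderiv K) (w j).
  rewrite wk big_enum (bigD1 i) //= {1}/upd eqxx; congr (_ * _).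
  by apply: eq_bigr => j /negPf ji; rewrite /upd ji.
by rewrite !E iter_lderiv_linear mulrDl scalerAl.
Qed.

(** * The bracket of operators w d^p *)

Section Bracket.
Variable K : comNzRingType.
Local Notation L := (laurent K).
Local Notation D := (@lderiv K).

Lemma wdp_linear p : linear (fun w : L => wdp w p).
Proof.
by move=> c v w; apply/funext => f; rewrite /wdp mulrDl -scalerAl.
Qed.

Lemma wdp_sum (J : Type) (r : seq J) (c : J -> K) (w : J -> L) p :
  wdp (\sum_(j <- r) c j *: w j) p = \sum_(j <- r) c j *: wdp (w j) p.
Proof.
elim: r => [|j r IHr]; last by rewrite !big_cons wdp_linear IHr.
by rewrite !big_nil; apply/funext => f; rewrite /wdp mul0r.
Qed.

(** One more derivation d^p is put in front so that the composite of an empty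
    list yields d^p f, and the induction starts from the variable g = d^p f. *)
Lemma iter_lderiv_comp (I : Type) (r : seq I) (w : I -> L) p f :
  iter p D ((\big[@comp _ _ _/id]_(i <- r) wdp (w i) p) f) =
  foldr (fun i x => iter p D (w i * x)) (iter p D f) r.
Proof. by elim: r => [|i r IHr]; rewrite ?big_nil // big_cons /= /wdp IHr. Qed.

Lemma diffpoly_foldr (I : eqType) (r : seq I) p :
  diffpoly (map Some r ++ [:: None]) (p * size r)
    (fun v : option I -> L =>
       foldr (fun i x => iter p D (v (Some i) * x)) (v None) r).
Proof.
elim: r => [|i r IHr] /=; first by rewrite muln0; exact: diffpoly_var.
rewrite mulnS addnC.
have dM := diffpolyM (diffpoly_var K (Some i)) IHr.
exact: (diffpoly_iter_lderiv p dM).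
Qed.

(** Each composite ends with d^p, which acts on f alone, and the other N - 1
    factors d^p provide the weight p (N - 1).  When this is the critical weight,
    alternation leaves no derivative on d^p f, so the bracket is again of the
    form u d^p. *)
Lemma obracket_wdp N p : (0 < N)%N -> (p * N.-1 = \sum_(i < N) i)%N ->
  exists u : ('I_N -> L) -> L, diffpoly (enum 'I_N) (\sum_(i < N) i) u /\
    forall w, obracket (fun i => wdp (w i) p) = wdp (u w) p.
Proof.
move=> N0 pN; case er : (enum 'I_N) => [|i0 r].
  by have := size_enum_ord N; rewrite er => /= N00; rewrite -N00 in N0.
have sr : size r = N.-1.
  by have := size_enum_ord N; rewrite er => /(congr1 predn).
pose P (v : option 'I_N -> L) :=
  v (Some i0) * foldr (fun i x => iter p D (v (Some i) * x)) (v None) r.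
have dP : diffpoly (None :: map Some (enum 'I_N)) (\sum_(i < N) i) P.
  rewrite -pN -sr er.
  have dM := diffpolyM (diffpoly_var K (Some i0)) (diffpoly_foldr r p).
  apply: (perm_diffpoly _ dM).
  by rewrite catA perm_catC.
have [u [du Pu]] := alternate_diffpoly_max dP; rewrite -er.
exists u; split=> // w; apply/funext => f; rewrite /obracket fct_sumE.
rewrite /wdp -Pu; apply: eq_bigr => s _.
have -> : index_enum 'I_N = i0 :: r by rewrite -er enumT [index_enum _]unlock.
by rewrite big_cons /P /= -(iter_lderiv_comp r (w \o s)).
Qed.

End Bracket.

Lemma obracket_skew (K : comNzRingType) N
    (A : 'I_N -> laurent K -> laurent K) (t : 'S_N) :
  obracket (A \o t) = (-1) ^+ t *: obracket A.
Proof.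
rewrite /obracket scaler_sumr [RHS](reindex_inj (mulIg t)) /=.
apply: eq_bigr => s _; rewrite scalerA odd_permM signr_addb mulrCA -expr2.
rewrite sqrr_sign mulr1; congr (_ *: _); apply: eq_bigr => i _.
by rewrite /= permM.
Qed.

Lemma W_coef (K : comNzRingType) p (T : Type) (A : T -> W K p) :
  exists w, forall i, W_op (A i) = wdp (w i) p.
Proof.
have /boolp.choice[w Aw] : forall i, exists w, W_op (A i) = wdp w p.
  by move=> i; apply/in_WP; exact: W_opP.
by exists w.
Qed.

(** * Unshuffles and the Young subgroup *)

Section Unshuffles.
Variable m : nat.
Local Notation N := m.+1.
Local Notation n := (N.-1.*2.+1).
Implicit Types h s : 'S_n.

(** The Young subgroup S_N x S_(N-1), as the stabiliser of {0, ..., N - 1}. *)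
Local Notation young := ('N([set i : 'I_n | (i < N)%N] | 'P))%g.

Lemma youngP h : reflect (forall i, (h i < N)%N = (i < N)%N) (h \in young).
Proof.
by apply: (iffP astabsP) => H i; have := H i; rewrite !inE.
Qed.

Lemma tperm_young (i j : 'I_n) :
  (i < N)%N = (j < N)%N -> tperm i j \in young.
Proof. by move=> ij; apply/youngP => k; case: tpermP => // ->. Qed.

(** The Young subgroup is generated by the transpositions inside a block: as
    long as h moves some i, composing with the transposition of i and its
    preimage fixes i and moves no new point. *)
Lemma young_ind (Q : 'S_n -> Prop) : Q 1%g ->
  (forall h (i j : 'I_n), i != j -> (i < N)%N = (j < N)%N -> Q h ->
     Q (tperm i j * h)%g) ->
  forall h, h \in young -> Q h.
Proof.
move=> Q1 Qt h; have [k] := ubnP #|[set i | h i != i]|.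
elim: k h => // k IHk h hk hy.
have [i hi|h1] := pickP (fun i => h i != i); last first.
  suff -> : h = 1%g by [].
  by apply/permP => i; rewrite perm1; apply/eqP; rewrite -[_ == _]negbK h1.
pose j := (h^-1)%g i; have hj : h j = i by rewrite /j permKV.
have ij : i != j by apply: contraNneq hi => ij; rewrite {1}ij hj.
have bij : (i < N)%N = (j < N)%N by rewrite -[in LHS]hj (youngP _ hy).
rewrite -[h](mulKg (tperm i j)) tpermV; apply: Qt => //; apply: IHk.
  rewrite -ltnS; apply: leq_trans hk; rewrite ltnS; apply: proper_card.
  apply/properP; split; last first.
    by exists i; rewrite !inE ?hi // permM tpermL hj eqxx.
  apply/subsetP => x; rewrite !inE permM; case: tpermP => [->|->|//].
    by rewrite hj eqxx.
  by move=> _; rewrite hj.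
by rewrite groupM ?tperm_young.
Qed.

Lemma unshuffleP s :
  reflect (forall i j : 'I_n, (i < j)%N -> (i < N)%N = (j < N)%N ->
             (s i < s j)%N) (unshuffle s).
Proof.
apply: (iffP 'forall_forallP) => H i j.
  move=> ij bij; apply: (implyP (H i j)); rewrite ij /= (leqNgt N i) bij.
  exact: orbN.
apply/implyP => /andP[ij bij]; apply: H => //.
by case/orP: bij => bij; lia.
Qed.

(** By the rearrangement inequality, an h that maximises the sum of the
    products i * s (h i) sorts s inside each block: exchanging two values in
    the wrong order would increase the sum. *)
Lemma unshuffle_exists s : exists2 h, h \in young & unshuffle (h * s)%g.
Proof.
pose F h := (\sum_(i < n) i * s (h i))%N.
have y1 : 1%g \in young by exact: group1.
case: (arg_maxnP F y1) => h hy hmax; exists h => //.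
apply/unshuffleP => i j ij bij; rewrite !permM ltnNge.
apply/negP => le_sh.
have nij : j != i by rewrite -val_eqE /= neq_ltn ij orbT.
have := hmax _ (groupM (tperm_young bij) hy).
suff: (F h < F (tperm i j * h)%g)%N by move=> /leq_trans H /H; rewrite ltnn.
rewrite /F !(bigD1 (P := predT) i) //= !(bigD1 (P := fun k => k != i) j) //=.
rewrite !permM tpermL tpermR.
rewrite (eq_bigr (fun k : 'I_n => k * s ((tperm i j * h)%g k)))%N; last first.
  by move=> k /andP[ki kj]; rewrite permM tpermD // eq_sym.
rewrite !addnA ltn_add2r.
have lt_sh : (s (h j) < s (h i))%N.
  by rewrite ltn_neqAle le_sh val_eqE !(inj_eq perm_inj) nij.
rewrite -(subnKC (ltnW ij)) -(subnKC (ltnW lt_sh)).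
have: (0 < (j - i) * (s (h i) - s (h j)))%N by rewrite muln_gt0 !subn_gt0 ij.
move: (j - i)%N (s (h i) - s (h j))%N (i : nat) (s (h j) : nat) => d e x y.
by rewrite !mulnDl !mulnDr; lia.
Qed.

Lemma increasing_ord_ge q (f : 'I_q -> 'I_q) :
  (forall i j : 'I_q, (i < j)%N -> (f i < f j)%N) ->
  forall i : 'I_q, (i <= f i)%N.
Proof.
move=> fi [i iq]; elim: i iq => // i IHi iq.
apply: leq_ltn_trans (IHi (ltnW iq)) _; exact: fi.
Qed.

Lemma increasing_perm q (h : 'S_q) :
  (forall i j : 'I_q, (i < j)%N -> (h i < h j)%N) -> h = 1%g.
Proof.
move=> hi; apply/permP => i; rewrite perm1; apply/val_inj/eqP.
rewrite /= eqn_leq (increasing_ord_ge hi) andbT.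
have := @increasing_ord_ge _ (h^-1)%g _ (h i); rewrite permK.
apply=> {}i j ij; rewrite ltnNge leq_eqVlt; apply/negP => /orP[/eqP|/hi].
  by move/val_inj/perm_inj=> ji; rewrite ji ltnn in ij.
by rewrite !permKV ltnNge ltnW.
Qed.

(** If s and h * s both increase on each block, then so does h; as h preserves
    the blocks, which are intervals, it is increasing throughout. *)
Lemma unshuffle_young_eq1 s h :
  unshuffle s -> h \in young -> unshuffle (h * s)%g -> h = 1%g.
Proof.
move=> /unshuffleP us /youngP hy /unshuffleP uhs.
apply: increasing_perm => i j ij.
have [bij|bij] := eqVneq (i < N)%N (j < N)%N; last first.
  by have := hy i; have := hy j; move: bij; lia.
have := uhs i j ij bij; rewrite !permM; apply: contraTltn.
rewrite leq_eqVlt => /orP[/eqP/val_inj->|hji]; first by rewrite ltnn.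
by rewrite -leqNgt ltnW // us // !hy.
Qed.

(** The unshuffles form a transversal of the cosets of the Young subgroup. *)
Lemma sum_unshuffle (K : comNzRingType) (V : lmodType K) (g : 'S_n -> V) :
  (forall h s, h \in young -> g (h * s)%g = g s) ->
  \sum_s g s = #|young|%:R *: \sum_(s | unshuffle s) g s.
Proof.
move=> gy.
transitivity (\sum_s \sum_(h in young | unshuffle (h * s)%g) g s).
  apply: eq_bigr => s _; have [h0 h0y uh0] := unshuffle_exists s.
  rewrite (big_pred1 h0) // => h; apply/andP/eqP => [[hy uh]|-> //].
  (* h * s = (h * h0^-1) * (h0 * s) compares the unshuffles h * s and h0 * s *)
  apply/eqP; rewrite eq_mulgV1; apply/eqP.
  apply: (unshuffle_young_eq1 uh0); first by rewrite groupM ?groupV.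
  by rewrite mulgA mulgKV.
rewrite (exchange_big_dep (mem young)) /=; last by move=> s h _ /andP[].
rewrite scaler_nat -sumr_const; apply: eq_bigr => h hy.
rewrite [RHS](reindex_inj (mulgI h)) /=.
by apply: eq_big => s; rewrite ?hy // => _; rewrite gy.
Qed.

Section JacobiTerm.
Variables (K : comNzRingType) (V : lmodType K) (Delta : ('I_N -> V) -> V).
Hypotheses (Dlin : multilinear Delta) (Dskew : skew_symmetric Delta).

Lemma multilinearN a i x : Delta (upd a i (- x)) = - Delta (upd a i x).
Proof.
have D0 : Delta (upd a i 0) = 0.
  by have := Dlin a i (-1) 0 0; rewrite scaler0 addr0 scaleN1r addNr.
by have := Dlin a i (-1) x 0; rewrite D0 !addr0 !scaleN1r.
Qed.

Lemma skew_tperm a i j : i != j -> Delta (a \o tperm i j) = - Delta a.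
Proof. by move=> ij; rewrite Dskew odd_tperm ij scaleN1r. Qed.

(** A transposition in the first block exchanges two arguments of the inner
    bracket; one in the second block exchanges two arguments of the outer one
    other than its argument 0. *)
Lemma jacobi_term_tperm (a : 'I_n -> V) s (i j : 'I_n) :
  i != j -> (i < N)%N = (j < N)%N ->
  jacobi_term Delta a (tperm i j * s)%g = - jacobi_term Delta a s.
Proof.
move=> nij bij.
(* f and g locate in the permuted list the arguments of the inner and of the
   outer bracket; position 0 of the outer one holds the inner bracket, and the
   value of g there only serves to make g injective. *)
pose f (k : 'I_N) : 'I_n := inord k.
pose g (k : 'I_N) : 'I_n := if k == 0%N :> nat then ord0 else inord (N + k.-1).
have fE (k : 'I_N) : f k = k :> nat.
  by rewrite inordK //; have := ltn_ord k; lia.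
have gE (k : 'I_N) : g k = (if k == 0%N :> nat then 0 else N + k.-1)%N :> nat.
  by rewrite /g; case: eqP => // k0; rewrite inordK //; have := ltn_ord k; lia.
have fI : injective f.
  by move=> k l /(congr1 val) /=; rewrite !fE => /val_inj.
have gI : injective g.
  move=> k l /(congr1 val) /=; rewrite !gE => kl; apply: val_inj => /=.
  by move: kl; do 2!case: eqP; lia.
have JE t : jacobi_term Delta a t =
    Delta (upd (fun k => a (t (g k))) ord0 (Delta (fun k => a (t (f k))))).
  congr Delta; apply/funext => k; rewrite /upd /g -val_eqE /=.
  by case: eqP.
rewrite !{}JE; have [iN|iN] := ltnP i N.
  have jN : (j < N)%N by rewrite -bij.
  rewrite -multilinearN; congr Delta; apply/funext => k; rewrite /upd.
  case: eqP => [_|/eqP k0].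
    rewrite -(@skew_tperm _ (Ordinal iN) (Ordinal jN)) //.
    congr Delta; apply/funext => l; rewrite permM /=; congr (a (s _)).
    rewrite (inj_tperm _ _ _ fI); congr (tperm _ _ _); apply: val_inj;
      by rewrite /= fE.
  have k0' : (k == 0%N :> nat) = false := negPf k0.
  have gN : (N <= g k)%N by rewrite gE k0' leq_addr.
  by rewrite permM tpermD //; apply/eqP => E; move: gN;
    rewrite -E leqNgt ?iN ?jN.
have ltN (k : 'I_n) : (k - m < N)%N by have := ltn_ord k; lia.
have gi (k : 'I_n) : (N <= k)%N -> g (Ordinal (ltN k)) = k.
  move=> Nk; apply: ord_inj; transitivity (N + (k - m).-1)%N; last lia.
  by rewrite [LHS]gE /= subn_eq0 leqNgt Nk.
have ne0 (k : 'I_n) : (N <= k)%N -> Ordinal (ltN k) != ord0.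
  by rewrite -val_eqE /= subn_eq0 -ltnNge.
have jN : (N <= j)%N by rewrite leqNgt -bij -leqNgt.
rewrite -(@skew_tperm _ (Ordinal (ltN i)) (Ordinal (ltN j))); last first.
  by rewrite -(inj_eq gI) !gi.
congr Delta; apply/funext => k; rewrite /upd /=.
rewrite -[ord0 in RHS](tpermD (ne0 i iN) (ne0 j jN)).
rewrite (inj_eq perm_inj); case: eqP => [_|k0].
  congr Delta; apply/funext => l; rewrite permM.
  have fN : (f l < N)%N by rewrite fE.
  by rewrite tpermD //; apply/eqP => E; move: fN; rewrite -E ltnNge ?iN ?jN.
by rewrite permM -[in LHS](gi i) // -[in LHS](gi j) // -inj_tperm.
Qed.

Lemma jacobi_term_young (a : 'I_n -> V) h s : h \in young ->
  jacobi_term Delta a (h * s)%g = (-1) ^+ h *: jacobi_term Delta a s.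
Proof.
move: h; apply: young_ind => [|h i j ij bij IH].
  by rewrite mul1g odd_perm1 scale1r.
rewrite -mulgA jacobi_term_tperm // IH odd_permM odd_tperm ij.
by rewrite signr_addb mulN1r scaleNr.
Qed.

Lemma sum_jacobi_term (a : 'I_n -> V) :
  \sum_s (-1) ^+ odd_perm s *: jacobi_term Delta a s =
  #|young|%:R *:
    \sum_(s | unshuffle s) (-1) ^+ odd_perm s *: jacobi_term Delta a s.
Proof.
apply: sum_unshuffle => h s hy; rewrite jacobi_term_young // scalerA.
by rewrite odd_permM addbC signr_addb -mulrA -expr2 sqrr_sign mulr1.
Qed.

End JacobiTerm.
End Unshuffles.

(** * The Jacobi identity *)

Lemma sum_ordE q : (\sum_(i < q) i = 'C(q, 2))%N.
Proof. by rewrite -bin2_sum big_mkord. Qed.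

Section Jacobi.
Variables (K : comNzRingType) (m : nat).
Local Notation N := m.+1.
Local Notation n := (N.-1.*2.+1).
Local Notation L := (laurent K).
Variable u : ('I_N -> L) -> L.

(** The coefficient of the nested bracket of jacobi_term when the bracket of
    the operators w_i d^p is u(w) d^p. *)
Definition nested (v : 'I_n -> L) : L :=
  u (fun i : 'I_N => if i == 0%N :> nat then u (fun j : 'I_N => v (inord j))
                     else v (inord (N + i.-1))).

Lemma diffpoly_nested d :
  diffpoly (enum 'I_N) d u -> diffpoly (enum 'I_n) (d + d) nested.
Proof.
move=> du.
have du0 : diffpoly (map (fun j : 'I_N => inord j) (enum 'I_N)) d
    (fun v : 'I_n -> L => u (fun j : 'I_N => v (inord j))).
  have := diffpoly_comp du (fun j : 'I_N => diffpoly_var K (inord j : 'I_n)).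
  by rewrite big1 // addn0 flatten_map1.
(* Content and weight of the argument i of the outer u; concatenated, the
   contents list all the variables in order. *)
pose e (i : 'I_N) : seq 'I_n :=
  if i == 0%N :> nat then map (fun j : 'I_N => inord j) (enum 'I_N)
  else [:: inord (N + i.-1)].
pose d' (i : 'I_N) := if i == 0%N :> nat then d else 0%N.
have := @diffpoly_comp K _ _ _ _ _ e d' (fun i v =>
  if i == 0%N :> nat then u (fun j : 'I_N => v (inord j))
  else v (inord (N + i.-1))) du.
have -> : (\sum_(i <- enum 'I_N) d' i = d)%N.
  by rewrite big_enum /= big_ord_recl big1 // addn0.
have -> : flatten (map e (enum 'I_N)) = enum 'I_n.
  have e0 : map val (e ord0) = iota 0 N.
    rewrite -[RHS]val_enum_ord -map_comp; apply: eq_map => i /=.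
    by rewrite inordK //; have := ltn_ord i; lia.
  have eS : map val (flatten (map (e \o lift ord0) (enum 'I_m))) = iota N m.
    rewrite (_ : map _ _ = [seq [:: inord (N + val i)] | i <- enum 'I_m]) //.
    rewrite flatten_map1 -[in RHS](addn0 N) iotaDl -val_enum_ord -!map_comp.
    apply: eq_map => i; rewrite /= inordK //; have := ltn_ord i; lia.
  apply: (inj_map val_inj); rewrite val_enum_ord.
  rewrite [enum _ in LHS]enum_ordSl map_cons -map_comp [flatten _]/= map_cat.
  by rewrite e0 eS -iotaD; congr iota; rewrite -addnn addSn.
apply=> i; rewrite /e /d'; case: eqP => // _; exact: diffpoly_var.
Qed.

(** The weight N(N-1) is less than (2N-1)(N-1) = 0 + ... + (2N-2) for N > 1. *)
Lemma alternate_nested_eq0 w : (0 < m)%N ->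
  diffpoly (enum 'I_N) (\sum_(i < N) i) u ->
  \sum_(s : 'S_n) (-1) ^+ s *: nested (w \o s) = 0.
Proof.
move=> m0 /diffpoly_nested dn; apply: (alternate_diffpoly_eq0 _ dn).
rewrite !sum_ordE !bin2 /= -doubleMr doubleK mulSn.
have := odd_double_half (m.+1 * m); rewrite oddM /= andNb /=.
nia.
Qed.

End Jacobi.

Theorem theorem8 (R : realType) (N : nat) (N_ge2 : (2 <= N)%N)
    (N_even : ~~ odd N) :
  exists Delta : ('I_N -> W R[i] N./2) -> W R[i] N./2,
    (forall A : 'I_N -> W R[i] N./2,
       W_op (Delta A) = obracket (fun i => W_op (A i))) /\
    homotopy_lie Delta.
Proof.
case: N N_ge2 N_even => // m m0 Ne.
set p := m.+1./2.
have pN : (p * m.+1.-1 = \sum_(i < m.+1) i)%N.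
  by rewrite sum_ordE bin2 /= -[in RHS](even_halfK Ne) -/p -doubleMl doubleK.
have [u [du uE]] := @obracket_wdp R[i] m.+1 p isT pN.
have inW (A : 'I_m.+1 -> W R[i] p) : in_W p (obracket (fun i => W_op (A i))).
  have [w Aw] := W_coef A; apply/in_WP; exists (u w).
  by rewrite -uE; congr obracket; apply/funext.
pose Delta A := InW (inW A).
have DE A w : (forall i, W_op (A i) = wdp (w i) p) ->
    W_op (Delta A) = wdp (u w) p.
  by move=> Aw; rewrite /= -uE; congr obracket; apply/funext.
exists Delta; split=> //.
(* Multilinearity is that of u: operators are combined by combining their
   coefficients. *)
have Dlin : multilinear Delta.
  move=> A i c x y; have [w Aw] := W_coef A.
  have [wx xE] := in_WP _ _ (W_opP x); have [wy yE] := in_WP _ _ (W_opP y).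
  have updE z wz : W_op z = wdp wz p ->
      forall j, W_op (upd A i z j) = wdp (upd w i wz j) p.
    by move=> zE j; rewrite /upd; case: eqP.
  apply: val_inj; rewrite [LHS](DE _ (upd w i (c *: wx + wy))); last first.
    by apply: updE; rewrite wdp_linear -xE -yE.
  rewrite (diffpoly_multilinear du) wdp_linear.
  by rewrite -(DE _ _ (updE _ _ xE)) -(DE _ _ (updE _ _ yE)).
have Dskew : skew_symmetric Delta.
  by move=> A t; apply: val_inj; rewrite /= -obracket_skew.
split=> // A.
have [w Aw] := W_coef A.
have JE s : W_op (jacobi_term Delta A s) = wdp (nested u (w \o s)) p.
  by apply: (DE _ _) => i; case: eqP => // _; apply: (DE _ _).
have: \sum_s (-1) ^+ odd_perm s *: jacobi_term Delta A s = 0.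
  apply: val_inj; rewrite raddf_sum.
  transitivity (\sum_(s : 'S_(m.+1.-1.*2.+1))
      (-1) ^+ s *: wdp (nested u (w \o s)) p).
    by apply: eq_bigr => s _; rewrite -JE.
  rewrite -wdp_sum alternate_nested_eq0 //.
  by apply/funext => f; rewrite /wdp mul0r.
rewrite sum_jacobi_term // => /eqP.
rewrite scaler_eq0 pnatr_eq0 => /orP[|/eqP //].
by rewrite -leqn0 leqNgt cardG_gt0.
Qed.
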